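(* Let $a$ be a function on $\mathbf C^d\times\mathbf C^d$ such that $(z,w)\mapsto a(z,\overline w)$ is entire on $\mathbf C^{2d}$, and suppose $$|a(z,w)|\lesssim\langle(z,w)\rangle^N,\quad z,w\in\mathbf C^d,$$ for some $N\ge0$. Then $a$ is a polynomial in $z\in\mathbf C^d$ and $\overline w\in\mathbf C^d$ of degree at most $N$.
   Context: Here $(z,w)$ in $\langle(z,w)\rangle$ denotes the pair in $\mathbf C^{2d}$, so $\langle(z,w)\rangle=(1+|z|^2+|w|^2)^{1/2}$, and $\lesssim$ means inequality up to a constant independent of $z,w$. *)

(* Defs.v *)
From HB Require Import structures.
From mathcomp Require Import all_boot all_order all_algebra.
From mathcomp Require Import all_classical all_reals all_analysis.
From mathcomp Require Import complex.
(* The notations of mpoly clash with those of MathComp-Analysis. *)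
From mathcomp Require Import -(notations) mpoly.

Set Implicit Arguments.
Unset Strict Implicit.
Unset Printing Implicit Defensive.

Import Order.TTheory GRing.Theory Num.Theory.
Import numFieldNormedType.Exports.

Local Open Scope ring_scope.

(* Modulus and Euclidean norm with values in R: the library's `|x| takes its
   values in R[i], and on 'rV it is the sup norm. *)
Definition cabs (R : realType) (x : R[i]) : R := ComplexField.Normc.normc x.

Definition enorm (R : realType) (n : nat) (x : 'rV[R[i]]_n) : R :=
  Num.sqrt (\sum_(i < n) cabs (x ord0 i) ^+ 2).

Definition bracket (R : realType) (d : nat) (z w : 'rV[R[i]]_d) : R :=
  Num.sqrt (1 + enorm z ^+ 2 + enorm w ^+ 2).

Definition conjv (R : realType) (n : nat) (x : 'rV[R[i]]_n) : 'rV[R[i]]_n :=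
  map_mx (@conjc R) x.

(* Frechet differentiability over the scalar field K at every point; for
   K = R[i] this is complex differentiability, i.e. f is entire. K is kept
   abstract because the topology of 'rV[K]_n is inferred from that of K, which
   is not declared directly on R[i]. *)
Definition entire (K : numFieldType) (n : nat) (f : 'rV[K]_n -> K) : Prop :=
  forall x : 'rV[K]_n, differentiable f x.

Definition mpoly_eval (R : realType) (n : nat) (p : mpoly n R[i])
    (x : 'rV[R[i]]_n) : R[i] :=
  meval (fun i : 'I_n => x ord0 i) p.

(* msize p is 1 + deg p, or 0 if p = 0: the zero polynomial has degree at most
   N for every N >= 0. *)
Definition mpoly_deg_le (R : realType) (n : nat) (p : mpoly n R[i])
    (N : R) : Prop :=
  ((mpoly.msize p).-1)%:R <= N.

(* Main.v *)
(* Integral-free proof.  Restricted to a complex line, a(z, conj w) is an entire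
   function f of one variable with f(t) = o(|t|^m), where m = floor(N) + 1.
   Contour integrals over squares are replaced by midpoint sums on the dyadic
   subdivisions of the sides.  These sums are exactly additive when a square is
   cut in four and vanish exactly on affine functions, so that Goursat's
   bisection argument shows that they tend to 0 for every integrand that is
   complex differentiable off a point p and continuous at p.  For the integrand
   (f(z) - f(p)) / (z - p) on a large square centered at 0, expanding
   1 / (z - p) in powers of p / z shows that f(p) is, up to a small error, the
   value at p of a polynomial of size m not depending on p.  Hence f coincides
   with its Lagrange interpolant at 0, ..., m - 1.  Interpolating one coordinate
   after the other gives a polynomial in all the variables; comparing degrees
   along the lines through 0 shows that its terms of degree >= m can be
   dropped. *)
Require Import Defs.
From mathcomp Require Import all_boot all_order all_algebra.
From mathcomp Require Import all_classical all_reals all_analysis.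
From mathcomp Require Import complex.
From mathcomp Require Import -(notations) mpoly.
From mathcomp Require Import ring lra.

Set Implicit Arguments.
Unset Strict Implicit.
Unset Printing Implicit Defensive.

Import Order.TTheory GRing.Theory Num.Theory.
Import numFieldNormedType.Exports.

Local Open Scope ring_scope.

(** * The modulus on [R[i]] with real values *)

Section Cabs.
Variable R : realType.
Local Notation C := (R[i]).
Local Notation Re := (@complex.Re R).
Local Notation Im := (@complex.Im R).
Local Open Scope complex_scope.
Implicit Types z w : C.

Lemma normr_cabs z : `|z| = (cabs z)%:C.
Proof. by rewrite normc_def /cabs; case: z. Qed.

Lemma cabs_ge0 z : 0 <= cabs z.
Proof. by case: z => a b; exact: sqrtr_ge0. Qed.

Lemma cabs0 : cabs (0 : C) = 0.
Proof. exact: ComplexField.Normc.normc0. Qed.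

Lemma cabsM z w : cabs (z * w) = cabs z * cabs w.
Proof. exact: ComplexField.Normc.normcM. Qed.

Lemma cabsV z : cabs z^-1 = (cabs z)^-1.
Proof. exact: ComplexField.Normc.normcV. Qed.

Lemma cabsX z n : cabs (z ^+ n) = cabs z ^+ n.
Proof. by apply: complexI; rewrite rmorphXn /= -!normr_cabs normrX. Qed.

Lemma cabsN z : cabs (- z) = cabs z.
Proof. exact: normcN. Qed.

Lemma cabsB z w : cabs (z - w) = cabs (w - z).
Proof. by rewrite -opprB cabsN. Qed.

Lemma ler_cabsD z w : cabs (z + w) <= cabs z + cabs w.
Proof. exact: le_normcD. Qed.

Lemma ler_cabsB z w : cabs (z - w) <= cabs z + cabs w.
Proof. by rewrite -(cabsN w) ler_cabsD. Qed.

Lemma cabs_eq0 z : (cabs z == 0) = (z == 0).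
Proof.
by apply/eqP/eqP => [/ComplexField.Normc.eq0_normc //|->]; rewrite cabs0.
Qed.

Lemma cabs_gt0 z : (0 < cabs z) = (z != 0).
Proof. by rewrite lt_def cabs_ge0 andbT cabs_eq0. Qed.

Lemma ler_cabs_sum (I : Type) (r : seq I) (P : pred I) (F : I -> C) :
  cabs (\sum_(i <- r | P i) F i) <= \sum_(i <- r | P i) cabs (F i).
Proof.
elim/big_rec2: _ => [|i y1 y2 _ le12]; first by rewrite cabs0.
by rewrite (le_trans (ler_cabsD _ _)) // lerD2l.
Qed.

Lemma cabs_real (r : R) : cabs r%:C = `|r|.
Proof. by rewrite /cabs /= expr0n addr0 sqrtr_sqr. Qed.

Lemma cabs_i : cabs ('i%C : C) = 1.
Proof. by rewrite /cabs /= expr0n add0r expr1n sqrtr1. Qed.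

Lemma ler_Re_cabs z : `|Re z| <= cabs z.
Proof.
case: z => a b /=; rewrite -sqrtr_sqr ler_wsqrtr // lerDl.
exact: sqr_ge0.
Qed.

Lemma ler_Im_cabs z : `|Im z| <= cabs z.
Proof.
case: z => a b /=; rewrite -sqrtr_sqr ler_wsqrtr // lerDr.
exact: sqr_ge0.
Qed.

Lemma ler_cabs_ReIm z : cabs z <= `|Re z| + `|Im z|.
Proof.
rewrite {1}[z]complexE (le_trans (ler_cabsD _ _)) //.
by rewrite cabsM cabs_i mul1r !cabs_real.
Qed.

Lemma eq0_small_cabs z : (forall e : R, 0 < e -> cabs z <= e) -> z = 0.
Proof.
move=> small; apply/eqP; rewrite -cabs_eq0 eq_le cabs_ge0 andbT.
by apply/ler_addgt0Pl => e /small; rewrite addr0.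
Qed.

End Cabs.

(** * Midpoint sums *)

Section MidpointSums.
Variable R : realType.
Local Notation C := (R[i]).
Local Notation Re := (@complex.Re R).
Local Notation Im := (@complex.Im R).
Local Open Scope complex_scope.
Implicit Types (k h : C -> C) (x y s t : R) (n : nat).

(* The integrand of the contour integral over the boundary of the square with
   lower left corner (x, y) and side s, the four sides being run through
   simultaneously with parameter t. *)
Definition sides k x y s t : C :=
  k ((x + t) +i* y) + 'i%C * k ((x + s) +i* (y + t))
  - k ((x + t) +i* (y + s)) - 'i%C * k (x +i* (y + t)).

Definition midpoint s n (i : nat) : R := (i%:R + 2^-1) * (s / 2 ^+ n).

(** The midpoint rule with [2 ^ n] nodes per side for the counterclockwise contour integral. *)
Definition contour k x y s n : C :=
  (s / 2 ^+ n)%:C * \sum_(0 <= i < 2 ^ n) sides k x y s (midpoint s n i).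

Lemma midpoint_itv s n i : 0 < s -> (i < 2 ^ n)%N -> 0 < midpoint s n i < s.
Proof.
move=> s0 ltin; have p0 : 0 < 2 ^+ n :> R by rewrite exprn_gt0.
apply/andP; split; first by rewrite mulr_gt0 ?divr_gt0 // ltr_wpDl.
rewrite /midpoint mulrA ltr_pdivrMr // [ltRHS]mulrC ltr_pM2r //.
have : (i.+1%:R <= 2 ^+ n :> R) by rewrite -natrX ler_nat.
rewrite -addn1 natrD; lra.
Qed.

Lemma sidesB k h x y s t :
  sides (fun z => k z - h z) x y s t = sides k x y s t - sides h x y s t.
Proof. by rewrite /sides; ring. Qed.

Lemma contourB k h x y s n :
  contour (fun z => k z - h z) x y s n = contour k x y s n - contour h x y s n.
Proof.
rewrite /contour -mulrBr -sumrB; congr (_ * _).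
by apply: eq_bigr => i _; rewrite sidesB.
Qed.

Lemma contourZ c k x y s n :
  contour (fun z => c * k z) x y s n = c * contour k x y s n.
Proof.
rewrite /contour mulrCA [c * _]mulr_sumr; congr (_ * _).
by apply: eq_bigr => i _; rewrite /sides; ring.
Qed.

Lemma contour0 x y s n : contour (fun=> 0) x y s n = 0.
Proof.
rewrite /contour big1 ?mulr0 // => i _.
by rewrite /sides !mulr0 subr0 subr0 addr0.
Qed.

Lemma contourD k h x y s n :
  contour (fun z => k z + h z) x y s n = contour k x y s n + contour h x y s n.
Proof.
rewrite /contour -mulrDr -big_split /=; congr (_ * _).
by apply: eq_bigr => i _; rewrite /sides; ring.
Qed.

Lemma contour_sum (I : Type) (r : seq I) (F : I -> C -> C) x y s n :
  contour (fun z => \sum_(i <- r) F i z) x y s n =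
  \sum_(i <- r) contour (F i) x y s n.
Proof.
elim: r => [|i r IH].
  rewrite big_nil -[RHS](contour0 x y s n).
  by congr (contour _ x y s n); apply/funext => z; rewrite big_nil.
rewrite big_cons -IH -contourD; congr (contour _ x y s n).
by apply/funext => z; rewrite big_cons.
Qed.

(** Every summand vanishes: constants cancel between opposite sides, and for [b * z] bottom minus
    top is [- 'i * b * s], while right minus left, multiplied by ['i], is ['i * b * s]. *)
Lemma contour_affine a b x y s n : contour (fun z => a + b * z) x y s n = 0.
Proof.
rewrite /contour big1 ?mulr0 // => i _; rewrite /sides.
set t := midpoint _ _ _; apply/eqP; rewrite eq_complex.
by case: a b => [a1 a2] [b1 b2] /=; apply/andP; split; apply/eqP; ring.
Qed.

(** All five sums have the same mesh, and the nodes on a side are those on its two halves. The inner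
    edges are run through twice, in opposite directions, and cancel. *)
Lemma contour_split k x y s n :
  contour k x y s n.+1 =
    contour k x y (s / 2) n + contour k (x + s / 2) y (s / 2) n
  + contour k x (y + s / 2) (s / 2) n
  + contour k (x + s / 2) (y + s / 2) (s / 2) n.
Proof.
have p0 : 2 ^+ n != 0 :> R by rewrite expf_neq0.
have mesh : s / 2 ^+ n.+1 = s / 2 / 2 ^+ n by rewrite exprS; field.
rewrite /contour -mesh -!mulrDr; congr (_ * _).
rewrite expnS mul2n -addnn (@big_cat_nat _ _ _ (2 ^ n)%N) ?leq_addr //=.
rewrite -[in X in _ + X](add0n (2 ^ n)%N) big_addn addnK -!big_split /=.
apply: eq_bigr => i _.
have -> : midpoint s n.+1 i = midpoint (s / 2) n i by rewrite /midpoint mesh.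
have -> : midpoint s n.+1 (i + 2 ^ n) = s / 2 + midpoint (s / 2) n i.
  by rewrite /midpoint mesh natrD natrX; field.
rewrite /sides; set t := midpoint _ _ _.
have -> : x + s = x + s / 2 + s / 2 by field.
have -> : y + s = y + s / 2 + s / 2 by field.
rewrite !addrA; ring.
Qed.

Definition on_square x y s (z : C) : Prop :=
  [/\ x <= Re z <= x + s, y <= Im z <= y + s
    & [|| Re z == x, Re z == x + s, Im z == y | Im z == y + s]].

Lemma ler_contour k B x y s n : 0 < s ->
  (forall z, on_square x y s z -> cabs (k z) <= B) ->
  cabs (contour k x y s n) <= 4 * s * B.
Proof.
move=> s0 kB; have p0 : 0 < 2 ^+ n :> R by rewrite exprn_gt0.
rewrite cabsM cabs_real ger0_norm ?divr_ge0 ?(ltW s0) ?(ltW p0) //.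
have le_sum : cabs (\sum_(0 <= i < 2 ^ n) sides k x y s (midpoint s n i)) <=
    \sum_(0 <= i < 2 ^ n) (4 * B).
  rewrite (le_trans (ler_cabs_sum _ _ _)) //.
  rewrite big_nat [leRHS]big_nat ler_sum // => i /= /(midpoint_itv s0).
  move: (midpoint _ _ _) => t /andP[t0 ts].
  have b1 : cabs (k ((x + t) +i* y)) <= B.
    by apply: kB; split=> /=; rewrite ?eqxx ?orbT //; apply/andP; split; lra.
  have b2 : cabs (k ((x + s) +i* (y + t))) <= B.
    by apply: kB; split=> /=; rewrite ?eqxx ?orbT //; apply/andP; split; lra.
  have b3 : cabs (k ((x + t) +i* (y + s))) <= B.
    by apply: kB; split=> /=; rewrite ?eqxx ?orbT //; apply/andP; split; lra.
  have b4 : cabs (k (x +i* (y + t))) <= B.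
    by apply: kB; split=> /=; rewrite ?eqxx ?orbT //; apply/andP; split; lra.
  rewrite /sides (le_trans (ler_cabsB _ _)) // cabsM cabs_i mul1r.
  have := ler_cabsB (k ((x + t) +i* y) + 'i * k ((x + s) +i* (y + t)))
    (k ((x + t) +i* (y + s))).
  have := ler_cabsD (k ((x + t) +i* y)) ('i * k ((x + s) +i* (y + t))).
  rewrite cabsM cabs_i mul1r; lra.
rewrite (le_trans (ler_wpM2l _ le_sum)) ?divr_ge0 ?(ltW s0) ?(ltW p0) //.
rewrite big_const_nat iter_addr_0 subn0 -(mulr_natr (4 * B)) natrX.
rewrite (_ : s / 2 ^+ n * (4 * B * 2 ^+ n) = 4 * s * B) //.
by field; rewrite gt_eqF.
Qed.

End MidpointSums.

(** * Bisection and Goursat's lemma *)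

Section Bisection.
Variable R : realType.
Implicit Types (a b x y s : R).

Lemma nested_intervals (l u : nat -> R) :
    (forall n, l n <= l n.+1) -> (forall n, u n.+1 <= u n) ->
    (forall n, l n <= u n) ->
  exists a, forall n, l n <= a <= u n.
Proof.
move=> lS uS lu.
have l_mono : {homo l : m n / (m <= n)%N >-> m <= n}.
  by apply: homo_leq => // y x z; exact: le_trans.
have u_mono : {homo u : m n / (m <= n)%N >-> n <= m}.
  by apply: homo_leq => // y x z /[swap]; exact: le_trans.
have l_le_u m n : l m <= u n.
  rewrite (le_trans (l_mono _ _ (leq_maxl m n))) // (le_trans (lu _)) //.
  exact/u_mono/leq_maxr.
exists (sup (range l)) => n; apply/andP; split.
  by apply: ub_le_sup; [exists (u 0%N) => _ [m _ <-]; exact: l_le_u | exists n].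
by apply: ge_sup => [|_ [m _ <-] //]; exists (l 0%N), 0%N.
Qed.

Lemma halving_lt s e : 0 < e -> exists n, s / 2 ^+ n < e.
Proof.
move=> e0; exists (Num.bound (`|s| / e)).
rewrite ltr_pdivrMr ?exprn_gt0 // mulrC -ltr_pdivrMr //.
apply: (@le_lt_trans _ _ (`|s| / e)).
  by rewrite ler_pM2r ?invr_gt0 // ler_norm.
apply: lt_trans (archi_boundP _) _; first by rewrite divr_ge0 // ltW.
by rewrite -natrX ltr_nat ltn_expl.
Qed.

(** If [P] fails on a square, it fails on one of the quarters. The nested failing squares shrink to
    a point [(a, b)], where the local hypothesis is contradicted. *)
Lemma bisection (P : R -> R -> R -> Prop) :
    (forall x y s, 0 < s -> P x y (s / 2) -> P (x + s / 2) y (s / 2) ->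
       P x (y + s / 2) (s / 2) -> P (x + s / 2) (y + s / 2) (s / 2) ->
       P x y s) ->
    (forall a b, exists2 d, 0 < d & forall x y s, 0 < s < d ->
       x <= a <= x + s -> y <= b <= y + s -> P x y s) ->
  forall x y s, 0 < s -> P x y s.
Proof.
move=> Psplit Ploc x0 y0 s0 s0_gt0; apply: contrapT => nP0.
pose bad (q : R * R * R) := 0 < q.2 /\ ~ P q.1.1 q.1.2 q.2.
(* The premise [bad q] makes the relation total, as dependent choice requires. *)
pose child (q r : R * R * R) := bad q -> [/\ bad r, r.2 = q.2 / 2,
  q.1.1 <= r.1.1 <= q.1.1 + q.2 / 2 & q.1.2 <= r.1.2 <= q.1.2 + q.2 / 2].
have next q : {r | child q r}.
  apply: cid; have [[]|nbad] := pselect (bad q); last by exists q => /nbad.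
  case: q => [[x y] s] /= s_gt0 nP; have s2_gt0 : 0 < s / 2 by rewrite divr_gt0.
  have Hx : x <= x <= x + s / 2 by rewrite lexx lerDl ltW.
  have Hy : y <= y <= y + s / 2 by rewrite lexx lerDl ltW.
  have Hx' : x <= x + s / 2 <= x + s / 2 by rewrite lexx lerDl ltW.
  have Hy' : y <= y + s / 2 <= y + s / 2 by rewrite lexx lerDl ltW.
  have [P1|n1] := pselect (P x y (s / 2)); last by exists (x, y, s / 2).
  have [P2|n2] := pselect (P (x + s / 2) y (s / 2)).
    have [P3|n3] := pselect (P x (y + s / 2) (s / 2)).
      have [P4|n4] := pselect (P (x + s / 2) (y + s / 2) (s / 2)).
        by case: nP; exact: Psplit.
      by exists (x + s / 2, y + s / 2, s / 2).
    by exists (x, y + s / 2, s / 2).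
  by exists (x + s / 2, y, s / 2).
have [f [f0 fS]] := dependent_choice next (x0, y0, s0).
have fbad n : bad (f n).
  elim: n => [|n IH]; first by rewrite f0.
  by case: (fS n IH).
have sz n : (f n).2 = s0 / 2 ^+ n.
  elim: n => [|n IH]; first by rewrite f0 /= expr0 divr1.
  by case: (fS n (fbad n)) => _ -> _ _; rewrite IH exprS; field.
have [a aP] : exists a, forall n, (f n).1.1 <= a <= (f n).1.1 + (f n).2.
  apply: nested_intervals => n.
  - by case: (fS n (fbad n)) => _ _ /andP[].
  - by case: (fS n (fbad n)) => _ -> /andP[? ?] _; lra.
  - by case: (fbad n) => /ltW ? _; rewrite lerDl.
have [b bP] : exists b, forall n, (f n).1.2 <= b <= (f n).1.2 + (f n).2.
  apply: nested_intervals => n.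
  - by case: (fS n (fbad n)) => _ _ _ /andP[].
  - by case: (fS n (fbad n)) => _ -> _ /andP[? ?]; lra.
  - by case: (fbad n) => /ltW ? _; rewrite lerDl.
have [d d0 Pd] := Ploc a b.
have [n ltd] := halving_lt s0 d0.
case: (fbad n) => sn0; apply; apply: Pd; rewrite ?aP ?bP //.
by rewrite sn0 sz.
Qed.

End Bisection.

(** * Goursat's lemma for midpoint sums, with one exceptional point *)

Section Goursat.
Variable R : realType.
Local Notation C := (R[i]).
Local Notation Re := (@complex.Re R).
Local Notation Im := (@complex.Im R).
Local Open Scope complex_scope.
Implicit Types (k : C -> C) (x y s c t : R) (z p : C).

Definition cderivative k z (L : C) : Prop :=
  forall e : R, 0 < e -> exists2 d, 0 < d & forall w, cabs (w - z) < d ->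
    cabs (k w - k z - L * (w - z)) <= e * cabs (w - z).

Definition ccontinuous k z : Prop :=
  forall e : R, 0 < e -> exists2 d, 0 < d & forall w, cabs (w - z) < d ->
    cabs (k w - k z) <= e.

(** The signed square root of [t - c]: since [Num.sqrt] is 0 on negative reals, at most one term is
    nonzero. *)
Definition ssqrt c t : R := Num.sqrt (t - c) - Num.sqrt (c - t).

Lemma ssqrt_mono c t1 t2 : t1 <= t2 -> ssqrt c t1 <= ssqrt c t2.
Proof. by move=> le12; rewrite lerB // ler_wsqrtr //; lra. Qed.

(** With [u = t + s - c] and [v = c - t], the increment is the sum of the roots of [u] and [v], and
    its square is at least [u + v = s]. *)
Lemma ssqrt_increment c t s : t <= c <= t + s ->
  Num.sqrt s <= ssqrt c (t + s) - ssqrt c t.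
Proof.
move=> /andP[tc cts]; rewrite /ssqrt.
rewrite (@ler0_sqrtr _ (c - (t + s))); last by lra.
rewrite (@ler0_sqrtr _ (t - c)); last by lra.
rewrite subr0 sub0r opprK.
rewrite -[leRHS]ger0_norm ?addr_ge0 ?sqrtr_ge0 // -sqrtr_sqr ler_wsqrtr //.
rewrite sqrrD !sqr_sqrtr ?subr_ge0 //.
have : 0 <= Num.sqrt (t + s - c) * Num.sqrt (c - t) *+ 2.
  by rewrite mulrn_wge0 // mulr_ge0 ?sqrtr_ge0.
lra.
Qed.

(* An additive function of squares which dominates the area and, on squares
   containing p, also the side length; the latter makes mere continuity of the
   integrand at p sufficient in Goursat's lemma. *)
Definition weight p x y s : R := s ^+ 2
  + (ssqrt (Re p) (x + s) - ssqrt (Re p) x)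
  * (ssqrt (Im p) (y + s) - ssqrt (Im p) y).

(** The increments of [ssqrt] telescope in each coordinate, so their product is additive, as is the
    area. *)
Lemma weight_split p x y s : weight p x y s =
    weight p x y (s / 2) + weight p (x + s / 2) y (s / 2)
  + weight p x (y + s / 2) (s / 2) + weight p (x + s / 2) (y + s / 2) (s / 2).
Proof.
rewrite /weight.
have -> : x + s / 2 + s / 2 = x + s by field.
have -> : y + s / 2 + s / 2 = y + s by field.
by field.
Qed.

Lemma weight_ge_area p x y s : 0 <= s -> s ^+ 2 <= weight p x y s.
Proof.
by move=> s0; rewrite lerDl mulr_ge0 // subr_ge0 ssqrt_mono // lerDl.
Qed.

Lemma weight_ge_side p x y s : x <= Re p <= x + s -> y <= Im p <= y + s ->
  s <= weight p x y s.
Proof.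
move=> px py; have s0 : 0 <= s by case/andP: px => *; lra.
rewrite -{1}(sqr_sqrtr s0) expr2 ler_wpDl ?sqr_ge0 //.
by rewrite ler_pM ?sqrtr_ge0 ?ssqrt_increment.
Qed.

Lemma square_diameter x y s z p : x <= Re z <= x + s -> y <= Im z <= y + s ->
  x <= Re p <= x + s -> y <= Im p <= y + s -> cabs (z - p) <= 2 * s.
Proof.
move=> /andP[? ?] /andP[? ?] /andP[? ?] /andP[? ?].
rewrite (le_trans (ler_cabs_ReIm _)) // !raddfB /=.
have : `|Re z - Re p| <= s by rewrite ler_norml; apply/andP; split; lra.
have : `|Im z - Im p| <= s by rewrite ler_norml; apply/andP; split; lra.
lra.
Qed.

(** Sums and weights are both additive, so the bound passes from the quarters to the square. On
    small squares an affine approximation of [k] is subtracted, which leaves the sum unchanged. *)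
Lemma goursat_weight k p (r : R) : 0 < r -> ccontinuous k p ->
    (forall z, z != p -> exists L, cderivative k z L) ->
  forall x y s, 0 < s -> exists n0, forall n, (n0 <= n)%N ->
    cabs (contour k x y s n) <= r * weight p x y s.
Proof.
move=> r0 kp kdiff; apply: bisection.
  move=> x y s s_gt0 [n1 H1] [n2 H2] [n3 H3] [n4 H4].
  exists (maxn (maxn n1 n2) (maxn n3 n4)).+1 => -[//|n].
  rewrite ltnS !geq_max => /andP[/andP[/H1 {}H1 /H2 {}H2]].
  move=> /andP[/H3 {}H3 /H4 {}H4].
  have le2 z1 z2 (a1 a2 : R) : cabs z1 <= r * a1 -> cabs z2 <= r * a2 ->
      cabs (z1 + z2) <= r * (a1 + a2).
    move=> le1 le2; rewrite mulrDr (le_trans (ler_cabsD _ _)) //.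
    exact: lerD le1 le2.
  by rewrite contour_split weight_split !le2.
move=> a b; have [ab_p|ab_p] := eqVneq (a +i* b) p.
  (* Near [p] only the constant [k p] is subtracted. The perimeter [4 * s] times [r / 4] is [r * s],
     and the weight dominates the side of a square containing [p]. *)
  have [d d0 dP] := kp _ (divr_gt0 r0 (ltr0n _ 4)).
  exists (d / 2) => [|x y s /andP[s_gt0 s_lt] xa yb]; first by rewrite divr_gt0.
  exists 0%N => n _.
  have -> : contour k x y s n = contour (fun z => k z - (k p + 0 * z)) x y s n.
    by rewrite contourB contour_affine subr0.
  rewrite (le_trans (ler_contour n s_gt0 (B := r / 4) _)) //.
    move=> z [zx zy _]; rewrite mul0r addr0 dP //.
    apply: le_lt_trans (square_diameter zx zy _ _) _; rewrite -?ab_p //=; lra.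
  have -> : 4 * s * (r / 4) = r * s by field.
  by rewrite ler_pM2l // weight_ge_side // -ab_p.
(* Away from [p] the remainder is at most [r / 8] times the diameter bound [2 * s]; times the
   perimeter this is [r * s ^+ 2], and the weight dominates the area. *)
have [L kL] := kdiff _ ab_p; have [d d0 dP] := kL _ (divr_gt0 r0 (ltr0n _ 8)).
exists (d / 2) => [|x y s /andP[s_gt0 s_lt] xa yb]; first by rewrite divr_gt0.
exists 0%N => n _; pose q := a +i* b.
have -> : contour k x y s n =
    contour (fun z => k z - (k q - L * q + L * z)) x y s n.
  by rewrite contourB contour_affine subr0.
rewrite (le_trans (ler_contour n s_gt0 (B := r / 8 * (2 * s)) _)) //.
  move=> z [zx zy _].
  have zq : cabs (z - q) <= 2 * s.
    by apply: square_diameter zx zy _ _; rewrite /q.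
  have -> : k z - (k q - L * q + L * z) = k z - k q - L * (z - q) by ring.
  rewrite (le_trans (dP _ _)) ?ler_pM2l ?divr_gt0 //.
  by rewrite (le_lt_trans zq) //; lra.
have -> : 4 * s * (r / 8 * (2 * s)) = r * s ^+ 2 by field.
by rewrite ler_pM2l // weight_ge_area // ltW.
Qed.

Lemma goursat k p x y s : 0 < s -> ccontinuous k p ->
    (forall z, z != p -> exists L, cderivative k z L) ->
  forall e : R, 0 < e -> exists n0, forall n, (n0 <= n)%N ->
    cabs (contour k x y s n) <= e.
Proof.
move=> s0 kp kdiff e e0.
have w0 : 0 < weight p x y s.
  by rewrite (lt_le_trans _ (weight_ge_area _ _ _ (ltW s0))) // exprn_gt0.
have [n0 n0P] := goursat_weight (divr_gt0 e0 w0) kp kdiff x y s0.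
by exists n0 => n /n0P; rewrite divfK // gt_eqF.
Qed.

End Goursat.

(** * One-variable Liouville theorem *)

Section DifferenceQuotient.
Variable R : realType.
Local Notation C := (R[i]).
Local Open Scope complex_scope.
Implicit Types (f : C -> C) (p z : C).

Definition quotient f p (L : C) (z : C) : C :=
  if z == p then L else (f z - f p) / (z - p).

Lemma quotient_continuous f p L :
  cderivative f p L -> ccontinuous (quotient f p L) p.
Proof.
move=> fL e e0; have [d d0 dP] := fL e e0; exists d => // w /dP.
rewrite /quotient eqxx; case: eqVneq => [_ _|wp].
  by rewrite subrr cabs0 ltW.
have wp0 : w - p != 0 by rewrite subr_eq0.
rewrite -ler_pdivrMr ?cabs_gt0 // -cabsV -cabsM.
by rewrite mulrBl mulfK.
Qed.

(* If g is the quotient, the remainder of its expansion at z is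
   (f w - f z - L (w - z) - L' (w - z)^2) / (w - p) with L' as below. *)
Lemma quotient_derivative f p L0 z L : z != p -> cderivative f z L ->
  cderivative (quotient f p L0) z ((L - (f z - f p) / (z - p)) / (z - p)).
Proof.
move=> zp fL; set L' := _ / (z - p).
have zp0 : z - p != 0 by rewrite subr_eq0.
have D0 : 0 < cabs (z - p) by rewrite cabs_gt0.
set D := cabs (z - p) in D0.
have L'0 : 0 < cabs L' + 1 by rewrite ltr_wpDl ?cabs_ge0.
move=> e e0; have eD0 : 0 < e * D / 4 by rewrite divr_gt0 ?mulr_gt0.
have [d d0 dP] := fL _ eD0.
(* The bound [D / 2] keeps [w] at distance at least [D / 2] from [p]; the third bound makes the term
   in [L'] at most [e * D / 4] times [cabs (w - z)], like the first-order remainder. *)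
exists (Num.min d (Num.min (D / 2) (e * D / 4 / (cabs L' + 1)))).
  by rewrite !lt_min d0 !divr_gt0 ?mulr_gt0.
move=> w; rewrite !lt_min => /andP[/dP {}dP /andP[wD wL]].
have D_le : D <= cabs (z - w) + cabs (w - p).
  by rewrite /D -(subrKA w) ler_cabsD.
have D2_le : D / 2 <= cabs (w - p) by rewrite (cabsB z) in D_le; lra.
have wp0 : w - p != 0 by rewrite -cabs_gt0; lra.
rewrite /quotient (negPf zp) -[w == p]subr_eq0 (negPf wp0).
have -> : (f w - f p) / (w - p) - (f z - f p) / (z - p) - L' * (w - z) =
    (f w - f z - L * (w - z) - L' * (w - z) ^+ 2) / (w - p).
  by rewrite /L'; field; rewrite wp0 zp0.
rewrite cabsM cabsV ler_pdivrMr; last by lra.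
rewrite (le_trans (ler_cabsB _ _)) // cabsM cabsX.
set a := cabs (w - z) in wD wL dP *.
have a0 : 0 <= a by exact: cabs_ge0.
have La : cabs L' * a <= e * D / 4.
  by move: wL; rewrite ltr_pdivlMr //; lra.
have := ler_wpM2r a0 La; have := ler_wpM2l (mulr_ge0 (ltW e0) a0) D2_le; lra.
Qed.

Lemma goursat_quotient f p (x y s : R) : 0 < s ->
    (forall z, exists L, cderivative f z L) ->
  exists k : C -> C, (forall z, z != p -> k z = (f z - f p) / (z - p)) /\
    forall e : R, 0 < e -> exists n0, forall n, (n0 <= n)%N ->
      cabs (contour k x y s n) <= e.
Proof.
move=> s0 fdiff; have [L0 fL0] := fdiff p; exists (quotient f p L0); split.
  by move=> z /negPf; rewrite /quotient => ->.
apply: goursat (quotient_continuous fL0) _ => // z zp.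
by have [L fL] := fdiff z; eexists; apply: quotient_derivative fL.
Qed.

End DifferenceQuotient.

Section Liouville.
Variable R : realType.
Local Notation C := (R[i]).
Local Notation Re := (@complex.Re R).
Local Notation Im := (@complex.Im R).
Local Open Scope complex_scope.
Local Open Scope classical_set_scope.
Implicit Types (f k : C -> C) (p z : C) (r : R).

Local Notation centered k r n := (contour k (- r) (- r) (2 * r) n).

Lemma centered_cabs_ge r z : 0 < r -> on_square (- r) (- r) (2 * r) z ->
  r <= cabs z.
Proof.
move=> r0 [_ _]; have <- : r = - r + 2 * r by ring.
have rE : `|r| = r by rewrite gtr0_norm.
case/or4P => /eqP zE; [have := ler_Re_cabs z | have := ler_Re_cabs z
  | have := ler_Im_cabs z | have := ler_Im_cabs z]; by rewrite zE ?normrN rE.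
Qed.

(** The integral is 2 pi i, but a positive lower bound uniform in [r] and [n] suffices. Each side
    contributes imaginary part [r / (v ^+ 2 + r ^+ 2)] with [v ^+ 2 <= r ^+ 2], so a summand is at
    least [2 / r], over a length [2 * r]. *)
Lemma cabs_winding_ge r n : 0 < r -> 4 <= cabs (centered (fun z => z^-1) r n).
Proof.
move=> r0; have p0 : 0 < 2 ^+ n :> R by rewrite exprn_gt0.
have t0 : 0 <= 2 * r / 2 ^+ n by rewrite divr_ge0 ?mulr_ge0 ?ltW.
apply: le_trans (ler_Im_cabs _); apply: le_trans (ler_norm _).
have -> : 4 = 2 * r / 2 ^+ n * \sum_(0 <= i < 2 ^ n) (2 / r).
  rewrite big_const_nat iter_addr_0 subn0 -(mulr_natr (2 / r)) natrX.
  by field; rewrite !gt_eqF.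
have ImM (a : R) (z : C) : Im (a%:C * z) = a * Im z.
  by case: z => b c /=; rewrite mul0r addr0.
rewrite /contour ImM ler_wpM2l // raddf_sum.
rewrite big_nat [leRHS]big_nat ler_sum // => i /= ilt.
have /(midpoint_itv (s := 2 * r)) : (i < 2 ^ n)%N by [].
move=> /(_ (mulr_gt0 (ltr0n _ 2) r0)) /andP[].
move: (midpoint _ _ _) => t tl tr.
set v := - r + t; have D0 : 0 < v ^+ 2 + r ^+ 2.
  by rewrite ltr_wpDl ?sqr_ge0 ?exprn_gt0.
suff : 2 / r <= Im (sides (fun z => z^-1) (- r) (- r) (2 * r) t) by [].
have -> : Im (sides (fun z => z^-1) (- r) (- r) (2 * r) t) =
    4 * r / (v ^+ 2 + r ^+ 2).
  rewrite /sides /= -/v; have -> : - r + 2 * r = r by ring.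
  by field; rewrite !gt_eqF // addrC.
rewrite ler_pdivlMr // mulrAC ler_pdivrMr //.
have : 0 <= t * (2 * r - t) by rewrite mulr_ge0 ?subr_ge0 // ltW.
rewrite /v; lra.
Qed.

Lemma inv_subr_expansion (z p : C) m : z != 0 -> z - p != 0 ->
  (z - p)^-1 = \sum_(j < m) p ^+ j / z ^+ j.+1 + p ^+ m / z ^+ m / (z - p).
Proof.
move=> z0 zp0; elim: m => [|m IH].
  by rewrite big_ord0 !expr0 divr1 mul1r add0r.
rewrite big_ord_recr /= {1}IH -addrA; congr (_ + _).
have zm0 : z ^+ m != 0 by rewrite expf_neq0.
by rewrite !exprS; field; rewrite zm0 z0 zp0.
Qed.

(** An approximate Cauchy formula: the sums of the difference quotient [k] tend to 0, and the
    expansion of its kernel leaves an integrand [h] that is small compared with [1 / r]. The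
    threshold for [n] may depend on [r]. *)
Lemma liouville_approx f m p (e : R) :
    (forall z, exists L, cderivative f z L) ->
    (forall c : R, 0 < c -> exists r0, forall z, r0 <= cabs z ->
       cabs (f z) <= c * cabs z ^+ m) ->
    0 < e ->
  \forall r \near +oo, \forall n \near \oo,
    cabs (f p * centered (fun z => z^-1) r n
      - \sum_(j < m) p ^+ j * centered (fun z => f z / z ^+ j.+1) r n) <= e.
Proof.
move=> fdiff fsmall e0; pose P := cabs p; have P0 : 0 <= P by exact: cabs_ge0.
have Pm0 : 0 < P ^+ m + 1 by rewrite ltr_wpDl ?exprn_ge0.
(* The perimeter [8 * r] times the bound [2 / r] for the inverse of [z - p] is 16, and each of three
   errors gets [e / 3], whence 48. Adding 1 avoids a zero denominator. *)
pose c := e / 48 / (P ^+ m + 1); have c0 : 0 < c by rewrite !divr_gt0.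
have cPm : c * P ^+ m <= e / 48.
  rewrite /c mulrAC ler_pdivrMr // ler_pM2l ?divr_gt0 //; lra.
have [r0 r0P] := fsmall c c0.
near=> r.
have r_gt0 : 0 < r by near: r; exact: nbhs_pinfty_gt.
have r0r : r0 <= r by near: r; apply: nbhs_pinfty_ge; exact: num_real.
have Pr : 2 * P <= r by near: r; apply: nbhs_pinfty_ge; exact: num_real.
have fpr : 48 / e * (cabs (f p) * P) <= r.
  by near: r; apply: nbhs_pinfty_ge; exact: num_real.
have [k [kE k_small]] :=
  goursat_quotient p (- r) (- r) (mulr_gt0 (ltr0n R 2) r_gt0) fdiff.
have [n0 n0P] := k_small _ (divr_gt0 e0 (ltr0n _ 3)).
exists n0 => // n /= /n0P {n0 n0P k_small} k_small.
pose h z := f p * z^-1 - \sum_(j < m) p ^+ j * (f z / z ^+ j.+1) + k z.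
have -> : f p * centered (fun z => z^-1) r n
      - \sum_(j < m) p ^+ j * centered (fun z => f z / z ^+ j.+1) r n =
    centered h r n - centered k r n.
  rewrite /h contourD contourB contourZ contour_sum addrK.
  by congr (_ - _); apply: eq_bigr => j _; rewrite contourZ.
rewrite (le_trans (ler_cabsB _ _)) // -[e]subr0 -(subrr (e / 3)) opprB addrA.
rewrite addrAC lerD //.
pose B := (c * P ^+ m + cabs (f p) * P / r) * (2 / r).
rewrite (le_trans (ler_contour n (mulr_gt0 (ltr0n R 2) r_gt0) (B := B) _)) //.
  move=> z /(centered_cabs_ge r_gt0) rz.
  have z_gt0 : 0 < cabs z by exact: lt_le_trans rz.
  have z0 : z != 0 by rewrite -cabs_gt0.
  have zpr : r / 2 <= cabs (z - p).
    have := ler_cabsD (z - p) p; rewrite subrK -/P; lra.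
  have zp_gt0 : 0 < cabs (z - p) by rewrite (lt_le_trans _ zpr) ?divr_gt0.
  have zp0 : z - p != 0 by rewrite -cabs_gt0.
  have zm0 : z ^+ m != 0 by rewrite expf_neq0.
  have -> : h z = (f z / z ^+ m * p ^+ m - f p * p / z) / (z - p).
    rewrite /h kE; last by rewrite -subr_eq0.
    have -> : \sum_(j < m) p ^+ j * (f z / z ^+ j.+1) =
        f z * ((z - p)^-1 - p ^+ m / z ^+ m / (z - p)).
      rewrite (canLR (addrK _) (inv_subr_expansion m z0 zp0)) mulr_sumr.
      by apply: eq_bigr => j _; rewrite mulrCA.
    by field; rewrite zm0 z0 zp0.
  rewrite cabsM cabsV /B; apply: ler_pM; rewrite ?invr_ge0 ?cabs_ge0 //.
    rewrite (le_trans (ler_cabsB _ _)) // lerD //.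
      rewrite !cabsM cabsV !cabsX -/P ler_wpM2r ?exprn_ge0 //.
      by rewrite ler_pdivrMr ?exprn_gt0 // r0P // (le_trans r0r).
    rewrite !cabsM cabsV -/P ler_wpM2l ?mulr_ge0 ?cabs_ge0 //.
    by rewrite lef_pV2.
  by rewrite -[2 / r]invf_div lef_pV2 // posrE divr_gt0.
have -> : 4 * (2 * r) * B = 16 * (c * P ^+ m) + 16 * (cabs (f p) * P) / r.
  by rewrite /B; field; rewrite gt_eqF.
have : 16 * (cabs (f p) * P) / r <= e / 3.
  rewrite ler_pdivrMr //; move: fpr; rewrite mulrAC ler_pdivrMr //; lra.
lra.
Unshelve. all: by end_near. Qed.

Lemma natrC_inj : injective (fun i : nat => i%:R : C).
Proof. by move=> i j /eqP; rewrite eqr_nat => /eqP. Qed.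

Definition node_basis m (i : 'I_m) : {poly C} :=
  tnth (m.-lagrange (fun j : nat => j%:R : C)) i.

Lemma size_node_basis m (i : 'I_m) : (0 < m)%N -> size (node_basis i) = m.
Proof.
by move=> m0; rewrite /node_basis size_lagrange_ //; exact: natrC_inj.
Qed.

Lemma poly_interpolation m (q : {poly C}) z : (0 < m)%N -> (size q <= m)%N ->
  q.[z] = \sum_(i < m) q.[i%:R] * (node_basis i).[z].
Proof.
move=> m0 sq; rewrite {1}(lagrange_gen m0 natrC_inj sq) horner_sum.
by apply: eq_bigr => i _; rewrite hornerM hornerC.
Qed.

(* By liouville_approx, f is arbitrarily close to polynomials of size m on any
   finite set of points, so that it satisfies their linear relations. *)
Lemma liouville_interpolation f m z : (0 < m)%N ->
    (forall z, exists L, cderivative f z L) ->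
    (forall c : R, 0 < c -> exists r0, forall z, r0 <= cabs z ->
       cabs (f z) <= c * cabs z ^+ m) ->
  f z = \sum_(i < m) f i%:R * (node_basis i).[z].
Proof.
move=> m0 fdiff fsmall; apply/eqP; rewrite -subr_eq0; apply/eqP.
apply: eq0_small_cabs => e e0.
(* The 1 counts the error at [z], the other terms weight the errors at the nodes; errors of at most
   [e / S] then add up to at most [e]. *)
pose S := 1 + \sum_(i < m) cabs (node_basis i).[z].
have S0 : 0 < S by rewrite ltr_wpDr // sumr_ge0 // => i _; exact: cabs_ge0.
have eS0 : 0 < e / S by rewrite divr_gt0.
pose W r n := centered (fun z => z^-1) r n.
pose A r n := \poly_(j < m) centered (fun z => f z / z ^+ j.+1) r n.
pose close p r n := cabs (f p * W r n - (A r n).[p]) <= e / S.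
have near_close p : \forall r \near +oo, \forall n \near \oo, close p r n.
  have := liouville_approx p fdiff fsmall eS0.
  apply: filterS => r; apply: filterS => n; rewrite /close /A horner_poly.
  by under eq_bigr do rewrite mulrC.
near (pinfty_nbhs R) => r; near \oo => n.
have r0 : 0 < r by near: r; exact: nbhs_pinfty_gt.
have cz : close z r n by near: n; near: r; exact: near_close.
have ci : forall i : 'I_m, close i%:R r n.
  near: n; apply: filter_forall => i /=; move: i; near: r.
  by apply: filter_forall => i; exact: near_close.
have W1 : 1 <= cabs (W r n).
  by rewrite (le_trans _ (cabs_winding_ge n r0)) ?ler1n.
have : cabs ((f z - \sum_(i < m) f i%:R * (node_basis i).[z]) * W r n) <= e.
  (* The polynomial [A r n] is the same for all points and equals its own interpolant, so it
     cancels. *)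
  have -> : (f z - \sum_(i < m) f i%:R * (node_basis i).[z]) * W r n =
      (f z * W r n - (A r n).[z])
      - \sum_(i < m) (f i%:R * W r n - (A r n).[i%:R]) * (node_basis i).[z].
    rewrite (poly_interpolation z m0 (size_poly _ _ : (size (A r n) <= m)%N)).
    rewrite mulrBl -addrA -opprD -big_split mulr_suml /=; congr (_ - _).
    by apply: eq_bigr => i _; ring.
  rewrite (le_trans (ler_cabsB _ _)) // -[leRHS](divfK (lt0r_neq0 S0)) {2}/S.
  rewrite mulrDr mulr1 lerD //.
  rewrite (le_trans (ler_cabs_sum _ _ _)) // mulr_sumr ler_sum // => i _.
  by rewrite cabsM ler_wpM2r ?cabs_ge0 //; exact: ci.
apply: le_trans; rewrite cabsM ler_peMr ?cabs_ge0 //.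
Unshelve. all: by end_near. Qed.

End Liouville.

(** * Several variables *)

Section ComplexDerivative.
Local Open Scope classical_set_scope.

Lemma differentiable_line (K : numFieldType) (n : nat) (F : 'rV[K]_n -> K)
    (x v : 'rV[K]_n) : differentiable F x ->
  exists L, forall e : K, 0 < e -> exists2 d, 0 < d & forall h, `|h| < d ->
    `|F (h *: v + x) - F x - L * h| <= e * `|h|.
Proof.
move=> /(diff_derivable (v := v)) /cvg_ex[/= L /cvgrPdist_lt FL].
exists L => e /FL /nbhs_ballP[/= d d0 dP]; exists d => // h hd.
(* The limit defining the derivative says nothing at [h = 0]. *)
have [->|h0] := eqVneq h 0.
  by rewrite scale0r add0r mulr0 subrr subr0 normr0 mulr0.
have /dP /(_ h0) /ltW : ball 0 d h by rewrite /ball /= sub0r normrN.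
rewrite /= -(ler_pM2r (_ : 0 < `|h|)) ?normr_gt0 // -normrM distrC.
by rewrite -[h^-1 *: _]/(h^-1 * _) mulrBl mulrAC mulVf // mul1r.
Qed.

Variable R : realType.

Lemma entire_line (n : nat) (F : 'rV[R[i]]_n -> R[i]) (x v : 'rV[R[i]]_n) t :
  entire F -> exists L, cderivative (fun t => F (x + t *: v)) t L.
Proof.
move=> /(_ (x + t *: v)) /(differentiable_line v)[L FL]; exists L => e e0.
have [|[d d'] dd' dP] := FL (e%:C)%C; first by rewrite ltcR.
(* A positive element of [R[i]] has imaginary part 0, so the real part of the radius serves. *)
move: dd'; rewrite ltcE /= => /andP[/eqP d'0 d0]; exists d => // w wt.
have := dP (w - t); rewrite !normr_cabs d'0 ltcR => /(_ wt).
by rewrite -rmorphM /= lecR addrCA -scalerDl subrK.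
Qed.

End ComplexDerivative.

(** * From polynomials on lines to polynomials in all variables *)

Section SeparatelyPolynomial.
Variable R : realType.
Local Notation C := (R[i]).
Variables (n m : nat) (F : 'rV[C]_n -> C).
Hypothesis m_gt0 : (0 < m)%N.
Hypothesis F_line : forall (x v : 'rV[C]_n) (t : C),
  F (x + t *: v) = \sum_(i < m) F (x + i%:R *: v) * (node_basis R i).[t].

Lemma mpoly_of_poly (q : {poly C}) (j : 'I_n) :
  exists p : mpoly n C, forall x, mpoly_eval p x = q.[x ord0 j].
Proof.
exists (\sum_(k < size q) q`_k *: mpolyX C (mnm1 j) ^+ k) => x.
rewrite /mpoly_eval raddf_sum horner_coef; apply: eq_bigr => k _ /=.
by rewrite mevalZ rmorphXn /= mevalXU.
Qed.

Let mix (j : nat) (x y : 'rV[C]_n) : 'rV[C]_n :=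
  \row_l if (l < j)%N then x ord0 l else y ord0 l.

(** Induction on the number of free coordinates: [F] is interpolated along coordinate [j]. The
    values at the nodes are polynomials by induction, applied to [y] with that coordinate replaced
    by the node. *)
Lemma mpoly_mix j y : (j <= n)%N ->
  exists p : mpoly n C, forall x, F (mix j x y) = mpoly_eval p x.
Proof.
elim: j y => [|j IH] y ltjn.
  exists (mpolyC n (F y)) => x; rewrite /mpoly_eval mevalC; congr F.
  by apply/rowP => l; rewrite mxE ltn0.
pose l0 := Ordinal ltjn.
pose upd c : 'rV[C]_n := \row_l if l == l0 then c else y ord0 l.
have updE x c : mix j x (upd c) = mix j x (upd 0) + c *: delta_mx ord0 l0.
  apply/rowP => l; rewrite !mxE eqxx /=; case: eqVneq => [->|] /=.
    by rewrite ltnn add0r mulr1.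
  by rewrite mulr0 addr0.
have mixS x : mix j.+1 x y = mix j x (upd (x ord0 l0)).
  apply/rowP => l; rewrite !mxE ltnS leq_eqVlt.
  have [->|l_neq] := eqVneq l l0; first by rewrite eqxx ltnn.
  by rewrite (_ : (l == j :> nat) = false) //; apply/negbTE.
have /choice[p pP] (i : 'I_m) := IH (upd i%:R) (ltnW ltjn).
have /choice[q qP] (i : 'I_m) := mpoly_of_poly (node_basis R i) l0.
exists (\sum_(i < m) p i * q i) => x.
rewrite mixS updE F_line /mpoly_eval raddf_sum; apply: eq_bigr => i _ /=.
by rewrite mevalM -updE pP -qP.
Qed.

Lemma poly_eq_horner (p q : {poly C}) : (forall t, p.[t] = q.[t]) -> p = q.
Proof.
move=> pq; pose M := (maxn (size p) (size q)).+1.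
have sp : (size p <= M)%N by rewrite ltnW // ltnS leq_maxl.
have sq : (size q <= M)%N by rewrite ltnW // ltnS leq_maxr.
rewrite (lagrange_gen (ltn0Sn _) (@natrC_inj R) sp).
rewrite [RHS](lagrange_gen (ltn0Sn _) (@natrC_inj R) sq).
by apply: eq_bigr => i _; rewrite pq.
Qed.

(** The polynomial from [mpoly_mix] need not have total degree below [m]. For fixed [x], however,
    [F (t *: x)] has size at most [m] in [t], so the homogeneous parts of degree at least [m] vanish
    at [x]. *)
Lemma mpoly_separately :
  exists p : mpoly n C,
    (mpoly.msize p <= m)%N /\ forall x, F x = mpoly_eval p x.
Proof.
have [p pP] := mpoly_mix 0 (leqnn n).
have {}pP x : F x = mpoly_eval p x.
  by rewrite -pP; congr F; apply/rowP => l; rewrite mxE ltn_ord.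
exists (\sum_(k <- msupp p | (mdeg k < m)%N) mcoeff k p *: mpolyX C k); split.
  rewrite (leq_trans (mmeasure_sum _ _ _ _)) //.
  apply/bigmax_leqP_seq => k _ km.
  by rewrite (leq_trans (msizeZ_le _ _)) // msizeX.
move=> x; pose mon (k : multinom n) : C := \prod_(i < n) x ord0 i ^+ k i.
(* Both polynomials represent [F (t *: x)]: [q0] by interpolation, [q1] by collecting the monomials
   of [p] by degree. *)
pose q0 := \sum_(i < m) (F (i%:R *: x))%:P * node_basis R i.
pose q1 := \sum_(k <- msupp p) (mcoeff k p * mon k) *: 'X^(mdeg k).
have q01 : q0 = q1.
  apply: poly_eq_horner => t.
  have -> : q0.[t] = F (t *: x).
    rewrite -[t *: x]add0r F_line horner_sum; apply: eq_bigr => i _.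
    by rewrite hornerM hornerC add0r.
  rewrite pP /mpoly_eval mevalE horner_sum; apply: eq_bigr => k _.
  rewrite hornerZ hornerXn -mulrA; congr (_ * _).
  under [LHS]eq_bigr do rewrite mxE exprMn.
  by rewrite big_split /= prodrXr -mdegE mulrC.
have sq0 : (size q0 <= m)%N.
  rewrite (leq_trans (size_sum _ _ _)) //; apply/bigmax_leqP => i _.
  by rewrite mul_polyC (leq_trans (size_scale_leq _ _)) // size_node_basis.
have -> : F x = q0.[1].
  rewrite -[x in LHS]add0r -[x in LHS]scale1r F_line horner_sum.
  by apply: eq_bigr => i _; rewrite hornerM hornerC add0r.
(* At [t = 1] the value is the sum of the first [m] coefficients, which in [q1] come from the
   monomials of degree below [m]. *)
rewrite (horner_coef_wide _ sq0) q01.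
under eq_bigr do rewrite expr1n mulr1 coef_sum.
rewrite exchange_big /= /mpoly_eval raddf_sum [RHS]big_mkcond /=.
apply: eq_bigr => k _; rewrite mevalZ mevalX.
under eq_bigr do rewrite coefZ coefXn.
case: ltnP => [ltkm|lemk].
  rewrite (bigD1 (Ordinal ltkm)) //= eqxx mulr1 big1 ?addr0 // => i.
  by rewrite -val_eqE /= => /negPf ->; rewrite mulr0.
rewrite big1 // => i _; rewrite (_ : (_ == _) = false) ?mulr0 //.
by apply/negbTE; rewrite neq_ltn (leq_trans (ltn_ord i)).
Qed.

End SeparatelyPolynomial.

(** * Growth of the bracket along complex lines *)

Section Growth.
Variable R : realType.
Local Notation C := (R[i]).
Local Open Scope complex_scope.

Lemma powR_little_o (N M c : R) (m : nat) : N < m%:R -> 0 < c -> 0 <= M ->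
  exists2 r0, 1 <= r0 & forall r, r0 <= r -> M * r `^ N <= c * r ^+ m.
Proof.
move=> Nm c0 M0; have s0 : 0 < m%:R - N by rewrite subr_gt0.
exists (Num.max 1 ((M / c) `^ (m%:R - N)^-1)); first by rewrite le_max lexx.
move=> r; rewrite ge_max => /andP[r1 rM].
have r0 : 0 < r by exact: lt_le_trans r1.
have Mc : M / c <= r `^ (m%:R - N).
  have -> : M / c = ((M / c) `^ (m%:R - N)^-1) `^ (m%:R - N).
    by rewrite -powRrM mulVf ?gt_eqF // powRr1 // divr_ge0 // ltW.
  by rewrite ge0_ler_powR ?nnegrE ?powR_ge0 ?(ltW s0) ?(ltW r0).
rewrite -powR_mulrn ?(ltW r0) // -[m%:R in leRHS](subrK N) powRD; last first.
  by rewrite (gt_eqF r0) implybT.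
by rewrite mulrA ler_wpM2r ?powR_ge0 // mulrC -ler_pdivrMr.
Qed.

Lemma enorm_sqr n (x : 'rV[C]_n) :
  enorm x ^+ 2 = \sum_(i < n) cabs (x ord0 i) ^+ 2.
Proof. by rewrite sqr_sqrtr // sumr_ge0 // => i _; exact: sqr_ge0. Qed.

Lemma enorm_conjv n (x : 'rV[C]_n) : enorm (conjv x) = enorm x.
Proof.
congr Num.sqrt; apply: eq_bigr => i _; rewrite mxE; congr (_ ^+ 2).
by case: (x ord0 i) => a b; rewrite /cabs /= sqrrN.
Qed.

(** For [1 <= cabs t] the fixed part [cabs (x ord0 i)] is absorbed into its product with
    [cabs t]. *)
Lemma enorm_line n (x v : 'rV[C]_n) : exists2 c, 0 <= c &
  forall t : C, 1 <= cabs t -> enorm (x + t *: v) ^+ 2 <= c * cabs t ^+ 2.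
Proof.
exists (\sum_(i < n) (cabs (x ord0 i) + cabs (v ord0 i)) ^+ 2).
  by rewrite sumr_ge0 // => i _; exact: sqr_ge0.
move=> t t1; rewrite enorm_sqr mulr_suml ler_sum // => i _.
rewrite !mxE -exprMn ler_pXn2r ?nnegrE ?mulr_ge0 ?addr_ge0 ?cabs_ge0 //.
rewrite (le_trans (ler_cabsD _ _)) // cabsM mulrDl [cabs t * _]mulrC lerD2r.
by rewrite ler_peMr // cabs_ge0.
Qed.

Lemma bracket_line d (z z' w w' : 'rV[C]_d) : exists2 c, 0 <= c &
  forall t : C, 1 <= cabs t ->
    bracket (z + t *: z') (conjv (w + t *: w')) <= c * cabs t.
Proof.
have [c1 c1_ge0 zc1] := enorm_line z z'.
have [c2 c2_ge0 wc2] := enorm_line w w'.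
exists (Num.sqrt (1 + c1 + c2)); first exact: sqrtr_ge0.
move=> t t1; have t0 : 0 <= cabs t by exact: cabs_ge0.
rewrite -(ger0_norm t0) -sqrtr_sqr -sqrtrM ?addr_ge0 // ler_wsqrtr //.
rewrite enorm_conjv !mulrDl mul1r !lerD ?zc1 ?wc2 //.
by rewrite exprn_ege1.
Qed.

End Growth.

Theorem corollary7p2 (R : realType) (d : nat)
    (a : 'rV[R[i]]_d -> 'rV[R[i]]_d -> R[i])
    (a_entire : @entire R[i] (d + d)
      (fun x : 'rV[R[i]]_(d + d) => a (lsubmx x) (conjv (rsubmx x))))
    (N : R) (N_ge0 : 0 <= N)
    (a_bound : exists K : R, forall z w : 'rV[R[i]]_d,
      cabs (a z w) <= K * bracket z w `^ N) :
  exists p : mpoly (d + d) R[i],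
    mpoly_deg_le p N /\
    forall z w : 'rV[R[i]]_d, a z w = mpoly_eval p (row_mx z (conjv w)).
Proof.
set F := fun x => _ in a_entire; have [K KP] := a_bound.
(* The least natural number exceeding [N]; size at most [m] means degree at most the integer part of
   [N]. *)
pose m := (Num.truncn N).+1.
have Nm : N < m%:R by exact: truncnS_gt.
have F_line x v t : F (x + t *: v) =
    \sum_(i < m) F (x + i%:R *: v) * (node_basis R i).[t].
  apply: (liouville_interpolation (f := fun t => F (x + t *: v))) => //.
    by move=> {}t; exact: entire_line.
  have [b b0 bP] := bracket_line (lsubmx x) (lsubmx v) (rsubmx x) (rsubmx v).
  move=> c c0.
  (* The absolute value is taken because [K] may be negative. *)
  have [|r0 r0_ge1 r0P] := @powR_little_o R N (`|K| * b `^ N) c m Nm c0.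
    by rewrite mulr_ge0 ?powR_ge0.
  exists r0 => {}t r0t; rewrite (le_trans _ (r0P _ r0t)) // /F.
  rewrite (le_trans (KP _ _)) // -mulrA -powRM ?cabs_ge0 //.
  rewrite (le_trans (ler_wpM2r (powR_ge0 _ _) (ler_norm K))) // ler_wpM2l //.
  rewrite !linearD !linearZ /= ge0_ler_powR ?nnegrE ?mulr_ge0 //;
    rewrite ?cabs_ge0 ?sqrtr_ge0 //.
  exact: bP (le_trans r0_ge1 r0t).
have [p [sp pE]] := mpoly_separately (ltn0Sn _) F_line.
exists p; split => [|z w].
  have : (Num.truncn N)%:R <= N by rewrite truncn_le.
  apply: le_trans; rewrite /mpoly_deg_le ler_nat.
  by case: (mpoly.msize p) sp.
rewrite -pE /F row_mxKl row_mxKr; congr (a z _).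
by apply/rowP => i; rewrite !mxE conjcK.
Qed.
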